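(* Let $\mathcal{A}$ be a unital associative algebra over $\mathbb{C}$, let $M$ be a finite-dimensional simple $\mathcal{A}$-module with action $\rho:\mathcal{A}\to\mathrm{End}_{\mathbb{C}}(M)$, and let $\widehat{G}$ be a finite abelian subgroup of $\mathrm{Aut}(\mathcal{A})$. Let $\widehat{H}=\{\sigma\in\widehat G\mid M^\sigma\cong M \text{ as }\mathcal{A}\text{-modules}\}$, a subgroup of $\widehat G$. Let $G=\mathrm{Hom}(\widehat G,\mathbb{C}^* )$, $H=\mathrm{Hom}(\widehat H,\mathbb{C}^* )$, and let $\psi:G\to H$ be the epimorphism given by restriction of maps to $\widehat H$. Then: (i) $\rho(\mathcal{A}^G_g)=\rho\big(\mathcal{A}^H_{\psi(g)}\big)$ for all $g\in G$. (ii) There is a bijective correspondence between thin $G$-coverings of $M$ and thin $H$-coverings of $M$: given a thin $H$-covering $\{M^H_h\mid h\in H\}$, one gets a thin $G$-covering $\{M^G_g\mid g\in G\}$ with $M^G_g=M^H_{\psi(g)}$, and every thin $G$-covering is of this form. (iii) All graded-simple $\mathcal{A}$-modules $\bigoplus_{g\in G}M_g$ (external direct sum) associated with the various thin $G$-coverings $\{M_g\mid g\in G\}$ of $M$ are isomorphic as graded $\mathcal A$-modules, up to shifts in the gradings on the modules.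
   Context: Modules are left modules. For $\sigma\in\mathrm{Aut}(\mathcal{A})$, $M^\sigma$ is the $\mathcal{A}$-module on the space $M$ with action $\rho\circ\sigma$. The groups $G$ and $H$ are written additively: $(g+h)(\sigma)=g(\sigma)h(\sigma)$. The algebra $\mathcal{A}$ is graded by $G$ and by $H$ via $\mathcal{A}^G_g=\{a\in\mathcal{A}\mid\sigma(a)=g(\sigma)a\ \forall\sigma\in\widehat G\}$ and $\mathcal{A}^H_h=\{a\in\mathcal{A}\mid\sigma(a)=h(\sigma)a\ \forall\sigma\in\widehat H\}$. For $F\in\{G,H\}$, an $F$-covering of $M$ is a family of subspaces $\{M_f\mid f\in F\}$ of $M$ with $\sum_fM_f=M$ and $\mathcal{A}^F_{f}M_{f'}\subseteq M_{f+f'}$ for all $f,f'\in F$. It is thin if whenever $\{N_f\}$ is an $F$-covering of $M$ with $N_f\subseteq M_f$ for all $f$, then $N_f=M_f$ for all $f$. For a thin $G$-covering $\{M_g\}$ of $M$, the external direct sum $\widetilde M=\bigoplus_{g\in G}M_g$ is a $G$-graded $\mathcal{A}$-module with $\widetilde M_g=M_g$ and $\mathcal{A}_g$ mapping $\widetilde M_h=M_h$ to $\widetilde M_{g+h}=M_{g+h}$ by the action on $M$; it is graded-simple (it has no proper nonzero graded submodules). *)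

(* Defs.v *)
From HB Require Import structures.
From mathcomp Require Import all_boot all_order all_fingroup all_algebra.
From mathcomp Require Import all_solvable separable cyclotomic mxrepresentation.
From mathcomp Require Import all_classical all_reals.
From mathcomp Require Import complex.

Set Implicit Arguments.
Unset Strict Implicit.
Unset Printing Implicit Defensive.

Import Order.TTheory GRing.Theory Num.Theory.

Local Open Scope ring_scope.

Section Dual.
Variables (C : numClosedFieldType) (K : finGroupType).

(* Hom(K, C^* ), written additively.  A multiplicative map with value 1 at 1
   has nonzero values, so C^* need not appear in the codomain. *)
Definition is_dual (f : {ffun K -> C}) : bool :=
  (f 1%g == 1) && [forall s, [forall t, f (s * t)%g == f s * f t]].

Record dual : predArgType := Dual {
  dual_fun :> {ffun K -> C};
  _ : is_dual dual_fun
}.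

HB.instance Definition _ := [isSub for dual_fun].
HB.instance Definition _ := [Choice of dual by <:].

Lemma dual1 (f : dual) : f 1%g = 1.
Proof. by case: f => f /= /andP[/eqP]. Qed.

Lemma dualM (f : dual) s t : f (s * t)%g = f s * f t.
Proof. by case: f => f /= /andP[_ /forallP/(_ s)/forallP/(_ t)/eqP]. Qed.

Lemma dualV (f : dual) s : f s^-1%g = (f s)^-1.
Proof.
have fK : f s * f s^-1%g = 1 by rewrite -dualM mulgV dual1.
have f0 : f s != 0 by apply/eqP => f0; move/eqP: fK; rewrite f0 mul0r eq_sym oner_eq0.
by apply: (mulfI f0); rewrite fK divff.
Qed.

Lemma dual_neq0 (f : dual) s : f s != 0.
Proof.
apply/eqP => f0; have := dualM f s s^-1%g.
by rewrite mulgV dual1 f0 mul0r => /eqP; rewrite oner_eq0.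
Qed.

Lemma dualP (f g : dual) : (forall s, f s = g s) <-> f = g.
Proof. by split=> [fg | -> //]; apply/val_inj/ffunP. Qed.

Fact dual_zero_subproof : is_dual [ffun=> 1].
Proof.
apply/andP; split; first by rewrite ffunE.
by apply/forallP => s; apply/forallP => t; rewrite !ffunE mulr1.
Qed.

Fact dual_opp_subproof (f : dual) : is_dual [ffun s => (f s)^-1].
Proof.
apply/andP; split; first by rewrite ffunE dual1 invr1.
by apply/forallP => s; apply/forallP => t; rewrite !ffunE dualM invfM.
Qed.

Fact dual_add_subproof (f g : dual) : is_dual [ffun s => f s * g s].
Proof.
apply/andP; split; first by rewrite ffunE !dual1 mulr1.
by apply/forallP => s; apply/forallP => t; rewrite !ffunE !dualM mulrACA.
Qed.

Definition dual_zero := Dual dual_zero_subproof.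
Definition dual_opp f := Dual (dual_opp_subproof f).
Definition dual_add f g := Dual (dual_add_subproof f g).

Fact dual_addA : associative dual_add.
Proof. by move=> f g h; apply/dualP => s; rewrite !ffunE mulrA. Qed.
Fact dual_addC : commutative dual_add.
Proof. by move=> f g; apply/dualP => s; rewrite !ffunE mulrC. Qed.
Fact dual_add0 : left_id dual_zero dual_add.
Proof. by move=> f; apply/dualP => s; rewrite !ffunE mul1r. Qed.
Fact dual_addN : left_inverse dual_zero dual_opp dual_add.
Proof. by move=> f; apply/dualP => s; rewrite !ffunE mulVf ?dual_neq0. Qed.

HB.instance Definition _ :=
  GRing.isZmodule.Build dual dual_addA dual_addC dual_add0 dual_addN.

Lemma dual0E s : (0 : dual) s = 1. Proof. by rewrite ffunE. Qed.
Lemma dualDE (f g : dual) s : (f + g) s = f s * g s. Proof. by rewrite ffunE. Qed.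
Lemma dualNE (f : dual) s : (- f) s = (f s)^-1. Proof. by rewrite ffunE. Qed.

(* Characters take values in the #|K|-th roots of unity; this is used to make
   dual a finType. *)
Definition dual_roots : seq C :=
  sval (closed_field_poly_normal ('X^#|K| - 1 : {poly C})).

Lemma dual_in_roots (f : dual) s : f s \in dual_roots.
Proof.
have fX n : f (s ^+ n)%g = f s ^+ n.
  by elim: n => [|n IHn]; rewrite ?expg0 ?expr0 ?dual1 // expgS exprS dualM IHn.
have fn : f s ^+ #|K| = 1.
  rewrite -fX -cardsT; have /dvdnP[m ->] := order_dvdG (finset.in_setT s).
  by rewrite mulnC expgM expg_order expg1n dual1.
rewrite /dual_roots; case: closed_field_poly_normal => r /= rE.
have : root ('X^#|K| - 1 : {poly C}) (f s).
  by rewrite /root !hornerE fn subrr.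
by rewrite rE rootZ ?root_prod_XsubC // lead_coef_eq0 -size_poly_eq0
           size_XnsubC //; apply/card_gt0P; exists s.
Qed.

Definition dual_code (f : dual) : {ffun K -> 'I_(size dual_roots).+1} :=
  [ffun s => inord (index (f s) dual_roots)].
Definition dual_decode (c : {ffun K -> 'I_(size dual_roots).+1}) : option dual :=
  insub [ffun s => nth 0 dual_roots (c s)].

Lemma dual_codeK : pcancel dual_code dual_decode.
Proof.
move=> f; rewrite /dual_decode.
suff -> : [ffun s => nth 0 dual_roots (dual_code f s)] = val f by rewrite valK.
apply/ffunP => s; rewrite !ffunE inordK ?nth_index ?dual_in_roots //.
by rewrite ltnS index_size.
Qed.

HB.instance Definition _ : isCountable dual := PCanIsCountable dual_codeK.
HB.instance Definition _ : isFinite dual := PCanIsFinite dual_codeK.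

End Dual.

Section DualOrthogonality.
Variables (C : numClosedFieldType) (K : finGroupType).
Hypothesis abK : abelian [set: K].

Lemma dual_separates (s : K) : s != 1%g -> exists f : dual C K, f s != 1.
Proof.
move=> s1; suff [n [rG fG]] : exists n (rG : mx_representation C [set: K]%G n),
    mx_faithful rG.
  have inT (x : K) : x \in [set: K]%G by rewrite inE.
  have rs1 : rG s != 1%:M.
    apply: contraNneq s1 => rs1; apply/eqP/(mx_faithful_inj fG); rewrite ?inT //.
    by rewrite rs1 repr_mx1.
  case: n rG rs1 {fG} => [|n] rG rs1.
    by rewrite [rG s]thinmx0 [1%:M]thinmx0 eqxx in rs1.
  have rX x k : rG (x ^+ k)%g = rG x ^+ k.
    elim: k => [|k IHk]; first by rewrite expg0 repr_mx1.
    by rewrite expgS exprS repr_mxM ?inT // IHk.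
  have [P Pu /allP/= PD] : codiagonalizable [seq rG x | x : K].
    apply/codiagonalizableP; split.
      move=> _ _ /mapP[x _ ->] /mapP[y _ ->].
      by rewrite /comm_mx -!repr_mxM ?inT // (centsP abK) ?inE.
    move=> _ /mapP[x _ ->]; apply/diagonalizableP.
    have K0 : (0 < #|K|)%N by apply/card_gt0P; exists s.
    have [r rE] := closed_field_poly_normal ('X^#|K| - 1 : {poly C}).
    have l1 : lead_coef ('X^#|K| - 1 : {poly C}) = 1.
      by apply/monicP/monicXnsubC.
    rewrite l1 scale1r in rE; exists r.
      rewrite -separable_prod_XsubC -rE separable_Xn_sub_1 //.
      by rewrite pnatr_eq0 -lt0n.
    rewrite -rE; apply: mxminpoly_min.
    rewrite rmorphB rmorph1 rmorphXn /= horner_mx_X -rX.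
    have -> : (x ^+ #|K|)%g = 1%g.
      rewrite -cardsT; have /dvdnP[m ->] := order_dvdG (finset.in_setT x).
      by rewrite mulnC expgM expg_order expg1n.
    by rewrite repr_mx1 subrr.
  have DP x : exists d, P *m rG x *m invmx P = diag_mx d.
    have /diagonalizable_forPex[d /(simmxRL Pu) <-] := PD (rG x) (map_f _ (mem_enum _ x)).
    by exists d.
  pose D x := P *m rG x *m invmx P.
  have D1 : D 1%g = 1%:M by rewrite /D repr_mx1 mulmx1 mulmxV.
  have DM x y : D (x * y)%g = D x *m D y.
    by rewrite /D repr_mxM ?inT // !mulmxA mulmxKV.
  have Dd i : is_dual [ffun x => D x i i].
    apply/andP; split; first by rewrite ffunE D1 mxE eqxx.
    apply/forallP => x; apply/forallP => y; rewrite !ffunE DM.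
    have [[d dE] [e eE]] := (DP x, DP y).
    by rewrite [D x]dE [D y]eE mulmx_diag !mxE eqxx !mulr1n.
  have [i iE] : exists i, D s i i != 1.
    apply/existsP; apply: contraNT rs1 => /existsPn all1.
    suff Ds1 : D s = 1%:M.
      apply/eqP/(can_inj (mulKmx Pu)); rewrite mulmx1 -[LHS](mulmxKV Pu).
      by rewrite -/(D s) Ds1 mul1mx.
    have [d dE] := DP s; rewrite -/(D s) in dE; rewrite dE in all1 *.
    apply/matrixP => i j; rewrite !mxE; have [_|//] := eqVneq i j.
    by move: (all1 i); rewrite negbK !mxE eqxx => /eqP ->.
  by exists (Dual (Dd i)); rewrite ffunE.
by exists _, (regular_repr C [set: K]%G); apply: regular_mx_faithful.
Qed.

Lemma sum_dual_group (f : dual C K) :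
  \sum_s f s = if f == 0 then #|K|%:R else 0.
Proof.
case: eqP => [->|f0].
  by rewrite (eq_bigr (fun=> 1)) ?sumr_const // => s _; rewrite dual0E.
have [t ft] : exists t, f t != 1.
  apply/existsP; apply: contra_notT f0 => /existsPn f1; apply/dualP => s.
  by rewrite dual0E; apply/eqP; move: (f1 s); rewrite negbK.
have tS : \sum_s f s = f t * \sum_s f s.
  rewrite mulr_sumr (reindex_inj (mulgI t)).
  by apply: eq_bigr => s _; rewrite dualM.
apply/eqP; have /eqP : (1 - f t) * \sum_s f s = 0 by rewrite mulrBl mul1r -tS subrr.
by rewrite mulf_eq0 subr_eq0 eq_sym (negPf ft).
Qed.

Lemma sum_dual_dual_neq1 (s : K) : s != 1%g -> \sum_(f : dual C K) f s = 0.
Proof.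
case/dual_separates => g gs.
have gS : \sum_(f : dual C K) f s = g s * \sum_(f : dual C K) f s.
  rewrite mulr_sumr (reindex_inj (addrI g)).
  by apply: eq_bigr => f _; rewrite dualDE.
apply/eqP; have /eqP : (1 - g s) * \sum_(f : dual C K) f s = 0.
  by rewrite mulrBl mul1r -gS subrr.
by rewrite mulf_eq0 subr_eq0 eq_sym (negPf gs).
Qed.

Lemma card_dual : #|dual C K| = #|K|.
Proof.
have: \sum_(f : dual C K) \sum_s f s = #|dual C K|%:R.
  rewrite exchange_big (bigD1 1%g) //= [X in _ + X]big1 => [|s /sum_dual_dual_neq1 //].
  by rewrite addr0 (eq_bigr (fun=> 1)) ?sumr_const // => f _; rewrite dual1.
rewrite (bigD1 (0 : dual C K)) //= [X in _ + X]big1 => [|f f0]; last first.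
  by rewrite sum_dual_group (negPf f0).
by rewrite addr0 (sum_dual_group 0) eqxx => /eqP; rewrite eqr_nat => /eqP ->.
Qed.

Lemma sum_dual_dual (s : K) :
  \sum_(f : dual C K) f s = if s == 1%g then #|K|%:R else 0.
Proof.
case: eqP => [->|/eqP/sum_dual_dual_neq1 //].
by rewrite -card_dual (eq_bigr (fun=> 1)) ?sumr_const // => f _; rewrite dual1.
Qed.

End DualOrthogonality.

Section Modules.
Variables (C : numClosedFieldType) (A : algType C).

Record fdmodule := FdModule {
  fdm_sort :> vectType C;
  fdm_act : {linear A -> 'End(fdm_sort)};
  fdm_act1 : fdm_act 1 = \1%VF;
  fdm_actM : forall a b, fdm_act (a * b) = (fdm_act a \o fdm_act b)%VF
}.

Definition submodule (M : fdmodule) (U : {vspace M}) : Prop :=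
  forall a, (fdm_act M a @: U <= U)%VS.

Definition simple_module (M : fdmodule) : Prop :=
  (fullv : {vspace M}) <> 0%VS /\
  forall U : {vspace M}, submodule U -> U = 0%VS \/ U = fullv.

Definition mod_iso (M N : fdmodule) (f : 'Hom(M, N)) : Prop :=
  bijective f /\ forall a v, f (fdm_act M a v) = fdm_act N a (f v).

Definition mod_isomorphic (M N : fdmodule) : Prop :=
  exists f : 'Hom(M, N), mod_iso f.

Section Twist.
Variables (M : fdmodule) (s : {lrmorphism A -> A}).

Fact twist1 : fdm_act M (s 1) = \1%VF.
Proof. by rewrite /= rmorph1 fdm_act1. Qed.

Fact twistM a b : fdm_act M (s (a * b)) = (fdm_act M (s a) \o fdm_act M (s b))%VF.
Proof. by rewrite /= rmorphM fdm_actM. Qed.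

Definition twist : fdmodule :=
  @FdModule M (fdm_act M \o s : {linear A -> 'End(M)}) twist1 twistM.

End Twist.

(* An isomorphism from the abstract finite abelian group K onto a subgroup of
   Aut(A) (with composition as product).  Each [aut_fun X s] is invertible,
   with inverse [aut_fun X s^-1]. *)
Record autgroup (K : finGroupType) := AutGroup {
  aut_fun :> K -> {lrmorphism A -> A};
  aut_abelian : abelian [set: K];
  aut_one : forall a, aut_fun 1%g a = a;
  aut_mul : forall s t a, aut_fun (s * t)%g a = aut_fun s (aut_fun t a);
  aut_inj : forall s t, aut_fun s =1 aut_fun t -> s = t
}.

Section Restriction.
Variables (K : finGroupType) (X : autgroup K) (L : {group K}).

Fact res_abelian : abelian [set: subg_of L].
Proof.
apply/centsP => s _ t _; apply/val_inj.
by apply: (centsP (aut_abelian X)); rewrite inE.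
Qed.

Definition autgroup_res : autgroup (subg_of L) :=
  @AutGroup (subg_of L) (fun s => X (sgval s)) res_abelian
    (aut_one X) (fun s t => aut_mul X (sgval s) (sgval t))
    (fun s t e => val_inj (aut_inj e)).

Fact dual_res_subproof (g : dual C K) : is_dual [ffun s : subg_of L => g (sgval s)].
Proof.
apply/andP; split; first by rewrite ffunE dual1.
by apply/forallP => s; apply/forallP => t; rewrite !ffunE dualM.
Qed.

Definition dual_res (g : dual C K) : dual C (subg_of L) := Dual (dual_res_subproof g).

Lemma dual_resE g s : dual_res g s = g (sgval s).
Proof. by rewrite ffunE. Qed.

Fact dual_res_is_additive : zmod_morphism dual_res.
Proof. by move=> f g; apply/dualP => s; rewrite !ffunE. Qed.

HB.instance Definition _ := GRing.isZmodMorphism.Build _ _ dual_res dual_res_is_additive.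

Lemma dual_res_surj (h : dual C (subg_of L)) : exists g, dual_res g = h.
Proof.
have abK := aut_abelian X.
apply: contrapT => /forallNP nh.
have : \sum_(g : dual C K) \sum_s (dual_res g - h) s = 0.
  by apply: big1 => g _; rewrite sum_dual_group subr_eq0 ifN //; apply/eqP/nh.
rewrite exchange_big /= (bigD1 1%g) //= [X in _ + X]big1 => [|s s1].
  rewrite addr0 (eq_bigr (fun=> 1)) => [|g _]; last exact: (dual1 (dual_res g - h)).
  rewrite sumr_const => /eqP; rewrite pnatr_eq0 (card_dual C abK).
  by rewrite -leqn0 leqNgt => /negP; apply; apply/card_gt0P; exists 1%g.
rewrite (eq_bigr (fun g : dual C K => g (sgval s) * (h s)^-1)) => [|g _].
  by rewrite -mulr_suml sum_dual_dual_neq1 ?mul0r // (inj_eq val_inj s 1%g).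
by rewrite !ffunE.
Qed.

End Restriction.

Section TwistGroup.
Variables (M : fdmodule) (K : finGroupType) (X : autgroup K).

(* The subgroup of those s with M^s isomorphic to M. *)
Definition twist_stab : {set K} := [set s | `[< mod_isomorphic (twist M (X s)) M >]]%SET.

Fact twist_stab_group_set : group_set twist_stab.
Proof.
apply/group_setP; split.
  rewrite inE; apply/asboolP; exists \1%VF; split.
    by exists id => v; rewrite id_lfunE.
  by move=> a v; rewrite !id_lfunE /= aut_one.
move=> s t; rewrite !finset.in_set => sS tS. move: sS => /asboolP[f [fb fE]].
move: tS => /asboolP[g [gb gE]].
pose h : 'Hom(M, M) := ((g : 'Hom(M, M)) \o (f : 'Hom(M, M)))%VF.
apply/asboolP; refine (ex_intro _ (h : 'Hom(twist M (X (s * t)%g), M)) _); split.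
  apply: (eq_bij (bij_comp gb fb)) => v; exact/esym/comp_lfunE.
by move=> a v; rewrite /= !comp_lfunE aut_mul /= fE gE.
Qed.

Canonical twist_stab_group := Group twist_stab_group_set.
End TwistGroup.

Section Graded.
Variables (K : finGroupType) (X : autgroup K).

(* a lies in the homogeneous component A_f. *)
Definition homog (f : dual C K) (a : A) : Prop := forall s, X s a = f s *: a.

Definition covering (M : fdmodule) (V : dual C K -> {vspace M}) : Prop :=
  (\sum_f V f)%VS = fullv /\
  forall f f' a v, homog f a -> v \in V f' -> fdm_act M a v \in V (f + f').

Definition thin_covering (M : fdmodule) (V : dual C K -> {vspace M}) : Prop :=
  covering V /\
  forall N : dual C K -> {vspace M},
    covering N -> (forall f, (N f <= V f)%VS) -> forall f, N f = V f.

Record gmodule := GModule {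
  gm_mod :> fdmodule;
  grade : dual C K -> {vspace gm_mod};
  grade_direct : directv (\sum_f grade f);
  grade_full : (\sum_f grade f)%VS = fullv;
  grade_act : forall f f' a v,
    homog f a -> v \in grade f' -> fdm_act gm_mod a v \in grade (f + f')
}.


(* Component of degree f of a, with respect to A = \bigoplus_f A_f. *)
Definition hcomp (f : dual C K) (a : A) : A :=
  #|K|%:R^-1 *: \sum_s (f s)^-1 *: X s a.

Fact hcomp_is_linear f : linear (hcomp f).
Proof.
move=> k a b; rewrite /hcomp scalerA mulrC -scalerA -scalerDr; congr (_ *: _).
rewrite scaler_sumr -big_split; apply: eq_bigr => s _ /=.
by rewrite linearP scalerDr !scalerA mulrC.
Qed.

HB.instance Definition _ f :=
  GRing.isLinear.Build C A A *:%R (hcomp f) (hcomp_is_linear f).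

Let cardK_neq0 : #|K|%:R != 0 :> C.
Proof. by rewrite pnatr_eq0 -lt0n; apply/card_gt0P; exists 1%g. Qed.

Lemma hcomp_homog f a : homog f (hcomp f a).
Proof.
move=> t; rewrite /hcomp linearZ /= linear_sum /= !scalerA mulrC -scalerA.
congr (_ *: _); rewrite [in RHS](reindex_inj (mulgI t)) scaler_sumr.
apply: eq_bigr => s _; rewrite linearZ /= aut_mul scalerA dualM invfM.
by rewrite mulrA divff ?mul1r ?dual_neq0.
Qed.

Lemma sum_hcomp a : \sum_f hcomp f a = a.
Proof.
rewrite -scaler_sumr exchange_big /= (bigD1 1%g) //= [X in _ + X]big1; last first.
  move=> s s1; rewrite -scaler_suml.
  rewrite (eq_bigr (fun f : dual C K => f s^-1%g)) => [|f _]; last by rewrite dualV.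
  rewrite (sum_dual_dual C (aut_abelian X)) ifN ?scale0r //.
  by rewrite invg_eq1.
rewrite addr0 -scaler_suml aut_one.
rewrite (eq_bigr (fun f : dual C K => f 1%g)) => [|f _]; last by rewrite dual1 invr1.
rewrite (sum_dual_dual C (aut_abelian X)) eqxx scalerA.
by rewrite mulVf ?scale1r.
Qed.

Lemma hcomp_id f a : homog f a -> forall g, hcomp g a = if g == f then a else 0.
Proof.
move=> ha g; rewrite /hcomp (eq_bigr (fun s => (f - g) s *: a)) => [|s _]; last first.
  by rewrite ha dualDE dualNE scalerA mulrC.
rewrite -scaler_suml sum_dual_group subr_eq0 eq_sym.
by case: eqP => _; rewrite ?scale0r ?scaler0 // scalerA mulVf ?scale1r.
Qed.

Lemma homog1 : homog 0 1.
Proof. by move=> s; rewrite rmorph1 dual0E scale1r. Qed.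

Lemma homogM f g a b : homog f a -> homog g b -> homog (f + g) (a * b).
Proof.
by move=> ha hb s; rewrite rmorphM /= ha hb dualDE -scalerAl -scalerAr scalerA.
Qed.

Section ExternalSum.
Variables (M : fdmodule) (V : dual C K -> {vspace M}) (cV : covering V).

(* a homogeneous of degree f maps w to k |-> a (w (k - f)). *)
Definition ext_act_fun (a : A) (w : {ffun dual C K -> M}) : {ffun dual C K -> M} :=
  [ffun k => \sum_f fdm_act M (hcomp f a) (w (k - f))].

Lemma ext_act_homog f a w k :
  homog f a -> ext_act_fun a w k = fdm_act M a (w (k - f)).
Proof.
move=> ha; rewrite ffunE (bigD1 f) //= big1 => [|g gf].
  by rewrite addr0 (hcomp_id ha) eqxx.
by rewrite (hcomp_id ha) (negPf gf) linear0 zero_lfunE.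
Qed.

Fact ext_act_linearr a : linear (ext_act_fun a).
Proof.
move=> k v w; apply/ffunP => g; rewrite !ffunE scaler_sumr -big_split /=.
by apply: eq_bigr => f _; rewrite !ffunE linearP.
Qed.

HB.instance Definition _ a :=
  GRing.isLinear.Build C {ffun dual C K -> M} {ffun dual C K -> M} *:%R
    (ext_act_fun a) (ext_act_linearr a).

Lemma ext_act_linearl k a b w :
  ext_act_fun (k *: a + b) w = k *: ext_act_fun a w + ext_act_fun b w.
Proof.
apply/ffunP => g; rewrite !ffunE scaler_sumr -big_split /=.
by apply: eq_bigr => f _; rewrite !linearP add_lfunE scale_lfunE.
Qed.

Lemma ext_act_suml (I : finType) (F : I -> A) w :
  ext_act_fun (\sum_i F i) w = \sum_i ext_act_fun (F i) w.
Proof.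
apply/ffunP => g; rewrite sum_ffunE ffunE.
under [RHS]eq_bigr do rewrite ffunE.
rewrite exchange_big; apply: eq_bigr => f _.
by rewrite !linear_sum sum_lfunE.
Qed.

Lemma ext_act_1 w : ext_act_fun 1 w = w.
Proof.
apply/ffunP => k; rewrite (ext_act_homog _ _ homog1) fdm_act1 id_lfunE.
by rewrite subr0.
Qed.

Lemma ext_act_M a b w : ext_act_fun (a * b) w = ext_act_fun a (ext_act_fun b w).
Proof.
rewrite -[a]sum_hcomp -[b]sum_hcomp mulr_suml !ext_act_suml.
apply: eq_bigr => f _; rewrite mulr_sumr ext_act_suml linear_sum /=.
apply: eq_bigr => g _; apply/ffunP => k.
rewrite (ext_act_homog _ _ (homogM (hcomp_homog f a) (hcomp_homog g b))).
rewrite !(ext_act_homog _ _ (hcomp_homog _ _)) fdm_actM comp_lfunE.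
by rewrite opprD addrA.
Qed.


Definition ext_eval (k : dual C K) (w : {ffun dual C K -> M}) : M := w k.

Fact ext_eval_is_linear k : linear (ext_eval k).
Proof. by move=> c v w; rewrite /ext_eval !ffunE. Qed.

HB.instance Definition _ k :=
  GRing.isLinear.Build C {ffun dual C K -> M} M *:%R
    (ext_eval k) (ext_eval_is_linear k).

Definition ext_coord (k : dual C K) : 'Hom({ffun dual C K -> M}, M) :=
  linfun (ext_eval k).

Lemma ext_coordE k w : ext_coord k w = w k.
Proof. exact: lfunE. Qed.

(* The external direct sum: families w with w k in V k for all k. *)
Definition ext_space : {vspace {ffun dual C K -> M}} :=
  (\bigcap_k (ext_coord k @^-1: V k))%VS.

Lemma ext_spaceP (w : {ffun dual C K -> M}) : reflect (forall k, w k \in V k) (w \in ext_space).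
Proof.
apply: (iffP subv_bigcapP) => wV k.
  by have := wV k isT; rewrite -memvE -memv_preim ext_coordE.
by move=> _; rewrite -memvE -memv_preim ext_coordE.
Qed.

Lemma ext_act_stable a (w : {ffun dual C K -> M}) : w \in ext_space -> ext_act_fun a w \in ext_space.
Proof.
move=> /ext_spaceP wV; apply/ext_spaceP => k; rewrite ffunE.
apply: memv_suml => f _; have := cV.2 _ _ _ _ (hcomp_homog f a) (wV (k - f)).
by rewrite addrCA subrr addr0.
Qed.

Definition ext_act (a : A) : 'End(subvs_of ext_space) :=
  linfun (vsproj ext_space \o ext_act_fun a \o vsval).

Lemma ext_actE a u : vsval (ext_act a u) = ext_act_fun a (vsval u).
Proof. by rewrite lfunE /= vsprojK // ext_act_stable // subvsP. Qed.

Fact ext_act_is_linear : linear ext_act.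
Proof.
move=> k a b; apply/lfunP => u; apply/val_inj.
rewrite add_lfunE scale_lfunE.
by rewrite [LHS]ext_actE ext_act_linearl -!ext_actE.
Qed.

HB.instance Definition _ :=
  GRing.isLinear.Build C A 'End(subvs_of ext_space) *:%R ext_act ext_act_is_linear.

Fact ext_act1 : ext_act 1 = \1%VF.
Proof.
by apply/lfunP => u; apply/val_inj; rewrite /= ext_actE ext_act_1 id_lfunE.
Qed.

Fact ext_actM a b : ext_act (a * b) = (ext_act a \o ext_act b)%VF.
Proof.
by apply/lfunP => u; apply/val_inj; rewrite /= comp_lfunE !ext_actE ext_act_M.
Qed.

Definition ext_mod : fdmodule := @FdModule (subvs_of ext_space) ext_act ext_act1 ext_actM.

(* The copy of V g inside the external direct sum: families supported at g. *)
Definition ext_grade (g : dual C K) : {vspace ext_mod} :=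
  (\bigcap_(k | k != g) lker (linfun (ext_coord k \o vsval : subvs_of ext_space -> M)))%VS.

Lemma ext_gradeP g (u : ext_mod) :
  reflect (forall k, k != g -> vsval u k = 0) (u \in ext_grade g).
Proof.
apply: (iffP subv_bigcapP) => uV k kg; have := uV k kg.
  by rewrite -memvE memv_ker lfunE /= ext_coordE => /eqP.
by move=> uk; rewrite -memvE memv_ker lfunE /= ext_coordE uk.
Qed.

Definition ext_inj (g : dual C K) (v : M) : ext_mod :=
  vsproj ext_space [ffun k => if k == g then v else 0].

Lemma ext_injE g v k : v \in V g -> vsval (ext_inj g v) k = if k == g then v else 0.
Proof.
move=> vV; rewrite /ext_inj vsprojK ?ffunE //.
by apply/ext_spaceP => h; rewrite ffunE; case: eqP => [->|_]; rewrite ?mem0v.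
Qed.

Lemma ext_inj_grade g v : v \in V g -> ext_inj g v \in ext_grade g.
Proof. by move=> vV; apply/ext_gradeP => k kg; rewrite ext_injE // (negPf kg). Qed.

Lemma ext_inj_sum (u : ext_mod) : u = \sum_g ext_inj g (vsval u g).
Proof.
apply/val_inj/ffunP => k; rewrite /= linear_sum sum_ffunE /= (bigD1 k) //= big1.
  rewrite addr0 ext_injE ?eqxx //; exact: (ext_spaceP _ (subvsP u)).
move=> g gk; rewrite ext_injE ?[k == g]eq_sym ?(negPf gk) //.
exact: (ext_spaceP _ (subvsP u)).
Qed.

Fact ext_grade_direct : directv (\sum_g ext_grade g).
Proof.
apply/directv_sum_independent => us usV us0 i _; apply/val_inj/ffunP => k /=.
rewrite [RHS]ffunE; have [->|ki] := eqVneq k i; last first.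
  exact: (ext_gradeP _ _ (usV i isT)).
have : vsval (\sum_j us j) i = 0 by rewrite us0 ffunE.
rewrite linear_sum sum_ffunE (bigD1 i) //= big1 ?addr0 // => j ji.
by apply: (ext_gradeP _ _ (usV j isT)); rewrite eq_sym.
Qed.

Fact ext_grade_full : (\sum_g ext_grade g)%VS = fullv.
Proof.
apply/vspaceP => u; rewrite memvf; rewrite [u]ext_inj_sum.
apply: memv_sumr => g _; apply: ext_inj_grade; exact: (ext_spaceP _ (subvsP u)).
Qed.

Fact ext_grade_act f g a (u : ext_mod) :
  homog f a -> u \in ext_grade g -> fdm_act ext_mod a u \in ext_grade (f + g).
Proof.
move=> ha /ext_gradeP ug; apply/ext_gradeP => k kfg.
rewrite /= ext_actE (ext_act_homog _ _ ha) ug ?linear0 //.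
by apply: contraNneq kfg => <-; rewrite addrC subrK.
Qed.

Definition ext_sum : gmodule :=
  @GModule ext_mod ext_grade ext_grade_direct ext_grade_full ext_grade_act.

End ExternalSum.

Definition graded_submodule (W : gmodule) (U : {vspace W}) : Prop :=
  submodule U /\ U = (\sum_f (U :&: grade W f))%VS.

Definition graded_simple_module (W : gmodule) : Prop :=
  (fullv : {vspace W}) <> 0%VS /\
  forall U : {vspace W}, graded_submodule U -> U = 0%VS \/ U = fullv.

Section Shift.
Variables (W : gmodule) (k : dual C K).

Let shift_bij : injective (fun f : dual C K => f + k) := addIr k.

Fact shift_direct : directv (\sum_f grade W (f + k)%R).
Proof.
apply/directv_sum_independent => us usW us0 f _.
have /directv_sum_independent dW := grade_direct W.
have := dW (fun f => us (f - k)); move=> /(_ _ _ (f + k) isT); rewrite addrK; apply.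
  by move=> g _; have := usW (g - k) isT; rewrite subrK.
rewrite (reindex_inj shift_bij) -[RHS]us0; apply: eq_bigr => g _.
by rewrite addrK.
Qed.

Fact shift_full : (\sum_f grade W (f + k)%R)%VS = fullv.
Proof. by rewrite -(grade_full W) [RHS](reindex_inj shift_bij). Qed.

Fact shift_act f f' a (v : W) :
  homog f a -> v \in grade W (f' + k) -> fdm_act W a v \in grade W (f + f' + k).
Proof. by move=> ha; rewrite -addrA; apply: grade_act. Qed.

Definition gshift : gmodule :=
  @GModule W (fun f => grade W (f + k)) shift_direct shift_full shift_act.

End Shift.

Definition gmod_isomorphic (W W' : gmodule) : Prop :=
  exists2 phi : 'Hom(W, W'), mod_iso phi &
    forall f, (phi @: grade W f)%VS = grade W' f.

Definition gmod_isomorphic_up_to_shift (W W' : gmodule) : Prop :=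
  exists k, gmod_isomorphic W (gshift W' k).

Lemma ext_sum_graded_simple (M : fdmodule) (V : dual C K -> {vspace M})
  (V_thin : thin_covering V) : simple_module M ->
  graded_simple_module (ext_sum (proj1 V_thin)).
Proof.
move: V_thin => [cV mV] [M0 simM]; split=> [/= e0|U [sU gU] /=].
  apply: M0; rewrite -cV.1; apply/eqP; rewrite -subv0.
  apply/subv_sumP => f _; apply/subvP => v vV.
  have := memvf (ext_inj cV f v); rewrite e0 => /vlineP[c]; rewrite scaler0 => e.
  have := @ext_injE _ _ cV f v f vV; rewrite e ffunE eqxx => <-.
  exact: mem0v.
pose co f : 'Hom(ext_mod cV, M) := linfun (ext_coord M f \o vsval : subvs_of (ext_space V) -> M).
have coE f u : co f u = vsval u f by rewrite lfunE /= ext_coordE.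
pose N f : {vspace M} := (co f @: (U :&: ext_grade cV f))%VS.
have NV f : (N f <= V f)%VS.
  apply/subvP => _ /memv_imgP[u _ ->]; rewrite coE; exact: (ext_spaceP _ _ (subvsP u)).
have Ninj f v : v \in N f -> ext_inj cV f v \in U.
  move=> /memv_imgP[u]; rewrite memv_cap => /andP[uU /ext_gradeP ug] ->.
  suff -> : ext_inj cV f (co f u) = u by [].
  apply/val_inj/ffunP => k /=; rewrite coE ext_injE; last first.
    exact: (ext_spaceP _ _ (subvsP u)).
  by case: eqP => [->//|/eqP kf]; rewrite ug.
have Nact f g a v : homog f a -> v \in N g -> fdm_act M a v \in N (f + g).
  move=> ha /memv_imgP[u]; rewrite memv_cap => /andP[uU ug] ->.
  apply/memv_imgP; exists (fdm_act (ext_mod cV) a u).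
    rewrite memv_cap (ext_grade_act ha ug : fdm_act (ext_mod cV) a u \in _) andbT.
    by apply: (subvP (sU a)); apply: memv_img.
  by rewrite !coE (ext_actE cV) (ext_act_homog _ _ ha) addrAC subrr add0r.
have sN : submodule (\sum_f N f)%VS.
  move=> a; apply/subvP => _ /memv_imgP[v /memv_sumP[w wN ->] ->].
  rewrite -[a]sum_hcomp linear_sum /=; apply: memv_suml => g _.
  rewrite linear_sum sum_lfunE; apply: memv_suml => f _.
  have := Nact _ _ _ _ (hcomp_homog f a) (wN g isT).
  by apply: subvP; apply: (sumv_sup (f + g)).
case: (simM _ sN) => [N0|N1]; [left|right].
  apply/eqP; rewrite -subv0; apply/subvP => u uU.
  move: uU; rewrite gU => /memv_sumP[w wU ->]; rewrite memv0; apply/eqP.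
  apply: big1 => f _; have := wU f isT; rewrite memv_cap => /andP[wfU /ext_gradeP wfg].
  apply/val_inj/ffunP => k; rewrite [RHS]ffunE /=.
  have [->|kf] := eqVneq k f; last exact: wfg.
  apply/eqP; rewrite -memv0 -N0 -coE; apply: (subvP (sumv_sup f _ _)) => //.
  by apply: memv_img; exact: (wU f isT).
have NE := mV N (conj N1 Nact) NV.
apply/vspaceP => u; rewrite memvf [u]ext_inj_sum.
apply: memv_suml => f _; apply: Ninj; rewrite NE.
exact: (ext_spaceP _ _ (subvsP u)).
Qed.

End Graded.
End Modules.

(* Main.v *)
Require Import Defs.
From HB Require Import structures.
From mathcomp Require Import all_boot all_order all_fingroup all_algebra.
From mathcomp Require Import spectral.
From mathcomp Require Import all_classical all_reals.
From mathcomp Require Import complex.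

(** Write rho for the action of A on M, K for the finite group of
automorphisms and S for the stabiliser of M in K (the elements s for which the
twisted module M^s is isomorphic to M).

(i) A component of the K-grading lies in the component of the S-grading whose
degree is the restricted character; what has to be shown is that an element
[a] of A of S-degree psi(g) has the same action on M as some element of
K-degree g. For s outside S the simple modules M^s are not isomorphic to M, so
by the density argument there is [e] in A that acts as 1 on M and as 0 on every
such M^s ([stab_separator]). The average #|S|^-1 * sum over s in K of
g(s)^-1 * s(a e) has K-degree g. On M its terms with s outside S vanish, and
each of the others acts as [a], since S fixes the action of [e] and multiplies
[a] by g(s). Hence the average acts as [a] ([homog_lift]).

(ii) If k is trivial on S, then by (i) some element of K-degree k acts as 1 on
M, so the subspaces of a K-covering satisfy V_g = V_(g+k). A K-covering is
therefore W o psi for a family W indexed by the characters of S, and (i) says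
that W o psi is a K-covering exactly when W is an S-covering
([covering_factor], [covering_comp]). This correspondence preserves inclusion
in both directions, hence thinness.

(iii) The external sums of thin coverings are graded-simple, and a homogeneous
element acts as 0 on such a sum iff it acts as 0 on M. So it suffices that two
graded-simple modules W, W' with the same homogeneous annihilators agree up to
shift ([graded_simple_unique]). Take [d] homogeneous with nonzero action on W
of the least possible rank. If v is a vector with d v <> 0 and a d v = 0 for a
homogeneous [a], then the homogeneous element [a d] has a larger kernel on W
than [d], so it acts as 0 on W and hence on W'. Thus,
for homogeneous v in W and v' in W' not killed by [d], every homogeneous [a]
with a d v = 0 also satisfies a d v' = 0, and a d v |-> a d v' is a well-defined
homomorphism from W to W', homogeneous of some degree; it is bijective because
any nonzero homogeneous vector generates a graded-simple module. *)

Import GRing.Theory Num.Theory.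

Set Implicit Arguments.
Unset Strict Implicit.
Unset Printing Implicit Defensive.

Local Open Scope ring_scope.
Local Open Scope classical_set_scope.

(** * Density for simple modules *)

(** Propositional subsets closed under linear combinations arise as orbits of
ideals in an algebra of arbitrary dimension; this turns them into subspaces.
The subspace is found by enlarging one contained in P until its dimension
cannot grow. *)
Lemma vspace_of_pred (F : fieldType) (V : vectType F) (P : V -> Prop) :
  P 0 -> (forall k x y, P x -> P y -> P (k *: x + y)) ->
  exists U : {vspace V}, forall x, x \in U <-> P x.
Proof.
move=> P0 PL.
suff grow n (U : {vspace V}) : (dim V - \dim U < n)%N -> (forall x, x \in U -> P x) ->
    exists U : {vspace V}, forall x, x \in U <-> P x.
  by apply: (grow _ 0%VS (ltnSn _)) => x; rewrite memv0 => /eqP ->.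
elim: n U => // n IHn U leUn UP.
have [PU|/existsNP[x /not_implyP[Px /negP xU]]] := pselect (forall x, P x -> x \in U).
  by exists U => x; split; [apply: UP | apply: PU].
apply: (IHn (<[x]> + U)%VS); last first.
  by move=> _ /memv_addP[_ /vlineP[k ->] [y /UP Py ->]]; apply: PL.
have ltU : (\dim U < \dim (<[x]> + U))%N.
  rewrite ltnNge; apply: contra xU => leU.
  have /eqP -> : U == (<[x]> + U)%VS by rewrite eqEdim addvSr.
  by rewrite (subvP (addvSl _ _)) ?memv_line.
have := dimvS (subvf (<[x]> + U)%VS); rewrite dimvf => leV.
by rewrite -ltnS (leq_ltn_trans _ leUn) // ltn_sub2l // (leq_trans ltU).
Qed.

Section Density.
Variables (C : numClosedFieldType) (A : algType C).
Implicit Types M N : fdmodule A.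

Lemma fdm_actME M a b (v : M) : fdm_act M (a * b) v = fdm_act M a (fdm_act M b v).
Proof. by rewrite fdm_actM comp_lfunE. Qed.

Lemma fdm_act1E M (v : M) : fdm_act M 1 v = v.
Proof. by rewrite fdm_act1 id_lfunE. Qed.

Lemma fdm_actDl M a b (v : M) : fdm_act M (a + b) v = fdm_act M a v + fdm_act M b v.
Proof. by rewrite linearD add_lfunE. Qed.

Lemma fdm_actZl M k a (v : M) : fdm_act M (k *: a) v = k *: fdm_act M a v.
Proof. by rewrite linearZ scale_lfunE. Qed.

Lemma fdm_act_suml M (I : Type) (r : seq I) (P : pred I) (F : I -> A) (v : M) :
  fdm_act M (\sum_(i <- r | P i) F i) v = \sum_(i <- r | P i) fdm_act M (F i) v.
Proof. by rewrite linear_sum sum_lfunE. Qed.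

Definition left_ideal (L : A -> Prop) : Prop :=
  [/\ L 0, forall k a b, L a -> L b -> L (k *: a + b) & forall a b, L b -> L (a * b)].

Definition module_hom M N (f : 'Hom(M, N)) : Prop :=
  forall a v, f (fdm_act M a v) = fdm_act N a (f v).

Lemma submoduleP M (U : {vspace M}) :
  submodule U <-> (forall a v, v \in U -> fdm_act M a v \in U).
Proof.
split=> [sU a v vU|sU a]; first by apply: (subvP (sU a)); apply: memv_img.
by apply/subvP => _ /memv_imgP[v vU ->]; apply: sU.
Qed.

Lemma simple_orbit M (L : A -> Prop) (w : M) :
  simple_module M -> left_ideal L -> (exists2 a, L a & fdm_act M a w <> 0) ->
  forall y, exists2 a, L a & fdm_act M a w = y.
Proof.
move=> [_ simM] [L0 LL LM] [a La aw] y.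
have [| |U UP] := @vspace_of_pred _ M (fun y => exists2 a, L a & fdm_act M a w = y).
- by exists 0; rewrite ?linear0 ?zero_lfunE.
- move=> k _ _ [b Lb <-] [c Lc <-]; exists (k *: b + c); first exact: LL.
  by rewrite fdm_actDl fdm_actZl.
apply/UP; case: (simM U) => [|U0|->]; last exact: memvf.
  apply/submoduleP => b _ /UP[c Lc <-]; apply/UP; exists (b * c); first exact: LM.
  by rewrite fdm_actME.
by case: aw; apply/eqP; rewrite -memv0 -U0; apply/UP; exists a.
Qed.

(** The map a w |-> a x is well defined on L w = N as soon as the annihilator of
w in L kills x. It is the source of all homomorphisms below. *)
Lemma cyclic_hom N M (L : A -> Prop) (w : N) (x : M) :
  left_ideal L ->
  (forall y, exists2 a, L a & fdm_act N a w = y) ->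
  (forall a, L a -> fdm_act N a w = 0 -> fdm_act M a x = 0) ->
  exists2 f : 'Hom(N, M), module_hom f &
    forall a, L a -> f (fdm_act N a w) = fdm_act M a x.
Proof.
move=> [L0 LL LM] gen wx.
pose c y := s2val (cid2 (gen y)).
have Lc y : L (c y) by rewrite /c; case: cid2.
have cE y : fdm_act N (c y) w = y by rewrite /c; case: cid2.
pose f y := fdm_act M (c y) x.
have fE a : L a -> f (fdm_act N a w) = fdm_act M a x.
  move=> La; apply/eqP; rewrite -subr_eq0 -scaleN1r addrC -fdm_actZl -fdm_actDl; apply/eqP.
  by apply: wx; [apply: LL | rewrite fdm_actDl fdm_actZl cE scaleN1r addNr].
have fL : linear f.
  move=> k y z; rewrite -{1}[y]cE -{1}[z]cE -fdm_actZl -fdm_actDl fE ?fdm_actDl ?fdm_actZl //.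
  exact: LL.
pose F : {linear N -> M} := HB.pack f (GRing.isLinear.Build C N M *:%R f fL).
exists (linfun F) => [a v|a La]; last by rewrite lfunE /= fE.
by rewrite !lfunE /= -{1}[v]cE -fdm_actME fE ?fdm_actME //; apply: LM.
Qed.

Lemma simple_hom_iso N M (f : 'Hom(N, M)) :
  simple_module N -> simple_module M -> module_hom f -> f <> 0 -> mod_iso f.
Proof.
move=> [_ simN] [_ simM] fA f0; split=> //.
have ker0 : lker f == 0%VS.
  case: (simN (lker f)) => [|->//|kerT].
    by apply/submoduleP => a v; rewrite !memv_ker fA => /eqP ->; rewrite linear0.
  by case: f0; apply/lfunP => v; apply/eqP; rewrite zero_lfunE -memv_ker kerT memvf.
have imT : limg f = fullv.
  case: (simM (limg f)) => [|im0|//].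
    apply/submoduleP => a _ /memv_imgP[v _ ->]; rewrite -fA.
    by apply/memv_img/memvf.
  case: f0; apply/lfunP => v; apply/eqP; rewrite zero_lfunE -memv0 -im0.
  exact/memv_img/memvf.
exists (f^-1)%VF; first exact: lker0_lfunK.
by move=> v; apply: limg_lfunVK; rewrite imT memvf.
Qed.

(** Schur's lemma: the eigenspace of an eigenvalue is a nonzero submodule. *)
Lemma schur_scalar M (f : 'Hom(M, M)) :
  simple_module M -> module_hom f -> exists c, f = c *: \1%VF.
Proof.
move=> [M0 simM] fA.
have dM : (0 < \dim (fullv : {vspace M}))%N.
  by rewrite lt0n dimv_eq0; apply/eqP.
have [c cE] : exists c, passmx.leigenvalue f c.
  have [c cE] := eigenvalue_closed (passmx.mxof (vbasis fullv) (vbasis fullv) f) dM.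
  exists c; rewrite /passmx.leigenvalue (passmx.leigenspaceE (vbasisP _)).
  by rewrite passmx.vsof_eq0 ?vbasisP.
exists c; case: (simM (passmx.leigenspace f c)) => [|e0|eT].
- apply/submoduleP => a v /eqlfunP fv; apply/eqlfunP.
  by rewrite fA fv !scale_lfunE !id_lfunE linearZ.
- by rewrite /passmx.leigenvalue e0 eqxx in cE.
by apply/lfunP => v; apply/eqlfunP; rewrite [lker _]eT memvf.
Qed.

Definition ann M (L : A -> Prop) (s : seq M) : A -> Prop :=
  fun a => L a /\ forall v, v \in s -> fdm_act M a v = 0.

Lemma ann_left_ideal M L s : left_ideal L -> left_ideal (@ann M L s).
Proof.
case=> L0 LL LM; split.
- by split=> // v _; rewrite linear0 zero_lfunE.
- move=> k a b [La as0] [Lb bs0]; split=> [|v vs]; first exact: LL.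
  by rewrite fdm_actDl fdm_actZl as0 ?bs0 // scaler0 addr0.
- move=> a b [Lb bs0]; split=> [|v vs]; first exact: LM.
  by rewrite fdm_actME bs0 // linear0.
Qed.

(** If L w = 0 the zero map does; otherwise L w = N because N is simple, and
[cyclic_hom] applies. *)
Lemma ann_step N M (L : A -> Prop) (w : N) (x : M) :
  simple_module N -> left_ideal L ->
  (forall a, L a -> fdm_act N a w = 0 -> fdm_act M a x = 0) ->
  exists2 f : 'Hom(N, M), module_hom f &
    forall a, L a -> f (fdm_act N a w) = fdm_act M a x.
Proof.
move=> simN idL wx.
have [ex|nex] := pselect (exists2 a, L a & fdm_act N a w <> 0).
  by apply: cyclic_hom => //; apply: simple_orbit.
exists 0 => [a v|a La]; rewrite !zero_lfunE ?linear0 //.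
by rewrite wx //; apply: contrapT => aw; apply: nex; exists a.
Qed.

(** Removing one vector v from the sequence costs a multiple of v: the
homomorphism a v |-> a (x - y) of [ann_step] is a scalar c by Schur's lemma,
so x - y - c v is killed by L. *)
Lemma ann_seq_span M (L : A -> Prop) (s : seq M) (x : M) :
  simple_module M -> left_ideal L ->
  (forall a, ann L s a -> fdm_act M a x = 0) ->
  exists2 y, y \in <<s>>%VS & forall a, L a -> fdm_act M a (x - y) = 0.
Proof.
move=> simM; elim: s L x => [|v s IHs] L x idL sx.
  by exists 0; rewrite ?mem0v // => a La; rewrite subr0 sx.
have [|a [[La av] as0]|y ys Ly] := IHs (ann L [:: v]) x.
- exact: ann_left_ideal.
- apply: sx; split=> // u; rewrite inE => /predU1P[->|/as0//].
  by apply: av; rewrite mem_head.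
have [|f fA fE] := @ann_step M M L v (x - y) simM idL.
  by move=> a La av; apply: Ly; split=> // u; rewrite inE => /eqP ->.
have [c cE] := schur_scalar simM fA.
exists (c *: v + y).
  by rewrite span_cons memv_add // memvZ ?memv_line.
move=> a La; rewrite opprD addrCA linearD linearN linearZ /=.
have <- := fE a La; rewrite cE scale_lfunE id_lfunE; exact: addNr.
Qed.

Lemma eq_on_vbasis (V W : vectType C) (f g : 'Hom(V, W)) :
  (forall v, v \in vbasis fullv -> f v = g v) -> f = g.
Proof.
move=> fg; apply/lfunP => v; apply/eqlfunP.
suff : (fullv <= lker (f - g))%VS by move/subvP; apply; rewrite memvf.
rewrite -(span_basis (vbasisP fullv)); apply/span_subvP => u /fg fgu.
exact/eqlfunP.
Qed.

(** For each v in a basis of M, the part of L that kills the other basis vectors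
does not kill v, hence moves v onto every vector of M, in particular onto v
itself. The sum of these elements over the basis acts as 1. *)
Lemma exists_act1 M (L : A -> Prop) :
  simple_module M -> left_ideal L ->
  (forall x, (forall a, L a -> fdm_act M a x = 0) -> x = 0) ->
  exists2 e, L e & forall v, fdm_act M e v = v.
Proof.
move=> simM idL faithL; pose b : seq M := vbasis (fullv : {vspace M}).
have fb : free b := basis_free (vbasisP fullv).
have isolate v : v \in b ->
    exists2 a, L a & forall u, u \in b -> fdm_act M a u = if u == v then v else 0.
  move=> vb; pose s := rem v b.
  have vs : v \notin <<s>>%VS.
    by move: fb; rewrite (perm_free (perm_to_rem vb)) free_cons => /andP[].
  have [] := @simple_orbit M (ann L s) v simM (ann_left_ideal _ idL) _ v.
    apply: contrapT => nex; have [|y ys Ly] := @ann_seq_span M L s v simM idL.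
      by move=> a La; apply: contrapT => av; apply: nex; exists a.
    by move: vs; rewrite (subr0_eq (faithL _ Ly)) ys.
  move=> a [La as0] av; exists a => // u ub; case: eqP => [->//|/eqP uv].
  by apply: as0; rewrite mem_rem_uniq ?free_uniq // inE uv.
have {}isolate v : exists a, v \in b ->
    L a /\ forall u, u \in b -> fdm_act M a u = if u == v then v else 0.
  have [/isolate[a La aE]|vb] := boolP (v \in b); first by exists a.
  by exists 0.
have [a aP] := choice isolate.
have [L0 LL LM] := idL; exists (\sum_(v <- b) a v).
  rewrite big_seq; elim/big_ind: _ => // [c d Lc Ld|v vb].
    by rewrite -[c]scale1r; apply: LL.
  by have [] := aP v vb.
move=> v; rewrite -[RHS](@id_lfunE _ M).
congr (fun_of_lfun _ v); apply: eq_on_vbasis => u ub; rewrite id_lfunE fdm_act_suml.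
rewrite (bigD1_seq u) ?free_uniq //= (aP u ub).2 // eqxx big_seq_cond big1 ?addr0 //.
by move=> w /andP[wb wu]; rewrite (aP w wb).2 // eq_sym (negPf wu).
Qed.

(** Restricting L to the annihilator of N loses nothing on M: the elements of L
that kill N are those killing a basis of N, and by [ann_step] each basis vector
can be dropped, because every homomorphism from N to M vanishes. *)
Lemma ann_simple_noniso N M (L : A -> Prop) (x : M) :
  simple_module N -> simple_module M -> ~ mod_isomorphic N M -> left_ideal L ->
  (forall a, L a -> fdm_act N a = 0 -> fdm_act M a x = 0) ->
  forall a, L a -> fdm_act M a x = 0.
Proof.
move=> simN simM niso idL.
suff ann_s (s : seq N) : (forall a, ann L s a -> fdm_act M a x = 0) ->
    forall a, L a -> fdm_act M a x = 0.
  move=> Nx; apply: (ann_s (vbasis fullv)) => a [La as0]; apply: Nx => //.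
  by apply: eq_on_vbasis => v /as0 ->; rewrite zero_lfunE.
elim: s => [|w s IHs] sx; first by move=> a La; apply: sx.
have [|f fA fE] := @ann_step N M (ann L s) w x simN (ann_left_ideal _ idL).
  move=> a [La as0] aw; apply: sx; split=> // u; rewrite inE => /predU1P[->//|].
  exact: as0.
apply: IHs => a La; rewrite -fE //; suff -> : f = 0 by rewrite zero_lfunE.
by apply: contrapT => f0; apply: niso; exists f; apply: simple_hom_iso.
Qed.

End Density.

(** * Lifting homogeneous elements from the stabiliser *)

Section Stabiliser.
Variables (C : numClosedFieldType) (A : algType C) (K : finGroupType).
Variables (X : autgroup A K) (M : fdmodule A).
Hypothesis simM : simple_module M.
Local Notation stab := (twist_stab_group M X).

Lemma mem_stab s : (s \in stab) <-> mod_isomorphic (twist M (X s)) M.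
Proof. by rewrite finset.in_set; split=> /asboolP. Qed.

Lemma aut_can s a : X s (X s^-1%g a) = a.
Proof. by rewrite -aut_mul mulgV aut_one. Qed.

Lemma twist_simple s : simple_module (twist M (X s)).
Proof.
have [M0 subM] := simM; split=> // U sU; apply: subM => a.
by have := sU (X s^-1%g a); rewrite /= aut_can.
Qed.

(** The left ideal of the elements that kill all twists of M by automorphisms
outside the stabiliser kills no nonzero vector of M, since the twists can be
removed one at a time by [ann_simple_noniso]. *)
Lemma stab_separator :
  exists2 e, (forall v, fdm_act M e v = v) &
    forall s, s \notin stab -> fdm_act M (X s e) = 0.
Proof.
pose L (r : seq K) a := forall s, s \in r -> fdm_act M (X s a) = 0.
have idL r : left_ideal (L r).
  split=> [s _|k a b La Lb s sr|a b Lb s sr]; first by rewrite !linear0.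
    by rewrite !linearP La ?Lb // scaler0 addr0.
  by rewrite rmorphM fdm_actM Lb // comp_lfun0r.
have faithL (r : seq K) x : {in r, forall s, s \notin stab} ->
    (forall a, L r a -> fdm_act M a x = 0) -> x = 0.
  elim: r => [|s r IHr] rS Lx; first by rewrite -(fdm_act1E x) Lx.
  apply: IHr => [t tr|]; first by apply: rS; rewrite inE tr orbT.
  apply: (ann_simple_noniso (twist_simple s) simM) (idL r) _.
    by move/mem_stab; apply/negP/rS/mem_head.
  by move=> a La as0; apply: Lx => t; rewrite inE => /predU1P[->//|/La].
have [|e Le eE] := exists_act1 simM (idL (enum (~: twist_stab M X)%SET)).
  by move=> x; apply: faithL => s; rewrite mem_enum finset.in_setC.
by exists e => // s sS; apply: Le; rewrite mem_enum finset.in_setC.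
Qed.

Lemma stab_aut_act s (e : A) : s \in stab ->
  (forall v, fdm_act M e v = v) -> forall v, fdm_act M (X s e) v = v.
Proof.
case/mem_stab => f [/bij_inj f_inj fA] e1 v; apply: f_inj.
by have := fA e v; rewrite e1.
Qed.

Lemma homog_dual_res g a : homog X g a -> homog (autgroup_res X stab) (dual_res stab g) a.
Proof. by move=> ha s; rewrite dual_resE; apply: ha. Qed.

(** The witness is the projection of a * e to degree g, where e is the separator
above. It averages over K, but only the terms in the stabiliser act on M; the
scalar #|K| / #|stab| corrects for that. *)
Lemma homog_lift g a :
  homog (autgroup_res X stab) (dual_res stab g) a ->
  exists2 b, homog X g b & fdm_act M b = fdm_act M a.
Proof.
move=> ha; have [e e1 e0] := stab_separator.
have K0 : #|K|%:R != 0 :> C.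
  by rewrite pnatr_eq0 -lt0n; apply/card_gt0P; exists 1%g.
have S0 : #|stab|%:R != 0 :> C by rewrite pnatr_eq0 -lt0n cardG_gt0.
exists ((#|K|%:R / #|stab|%:R) *: hcomp X g (a * e)).
  move=> s; rewrite linearZ /= hcomp_homog !scalerA; congr (_ *: _).
  by rewrite [_ * g s]mulrC.
apply/lfunP => v; rewrite /hcomp scalerA mulrAC divff // mul1r fdm_actZl fdm_act_suml.
rewrite (bigID (mem stab)) /= [X in _ + X]big1 ?addr0 => [|s /e0 es0]; last first.
  by rewrite fdm_actZl rmorphM fdm_actME es0 zero_lfunE linear0 scaler0.
rewrite (eq_bigr (fun=> fdm_act M a v)) => [|s sS].
  by rewrite sumr_const -scaler_nat scalerA mulVf ?scale1r.
rewrite fdm_actZl rmorphM fdm_actME (stab_aut_act sS e1).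
have := ha (subg stab s); rewrite dual_resE /= subgK // => ->; rewrite fdm_actZl scalerA.
by rewrite mulVf ?scale1r ?dual_neq0.
Qed.

Lemma homog_image g :
  fdm_act M @` [set a | homog X g a] =
  fdm_act M @` [set a | homog (autgroup_res X stab) (dual_res stab g) a].
Proof.
apply/seteqP; split=> _ [a ha <-]; first by exists a => //; apply: homog_dual_res.
by have [b hb bE] := homog_lift ha; exists b.
Qed.

(** * Coverings and restriction of characters *)

Local Notation psi := (@dual_res C K stab).

Lemma covering_comp (W : dual C (subg_of stab) -> {vspace M}) :
  covering X (W \o psi) <-> covering (autgroup_res X stab) W.
Proof.
have sumE : (\sum_g (W \o psi) g)%VS = (\sum_h W h)%VS.
  apply/eqP; rewrite eqEsubv; apply/andP; split; apply/subv_sumP => g _.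
    exact: (sumv_sup (psi g)).
  by have [k <-] := dual_res_surj X g; apply: (sumv_sup k).
rewrite /covering sumE; split=> -[Wfull Wact]; split=> // f h a v.
  have [[g <-] [k <-]] := (dual_res_surj X f, dual_res_surj X h).
  by move=> /homog_lift[b hb <-] vW; rewrite -raddfD; apply: Wact.
move=> /homog_dual_res ha vW; rewrite /= raddfD; exact: Wact.
Qed.

(** If g and k agree on the stabiliser, then 1, which has degree 0 there, lifts
to an element of degree k - g; it acts as 1 and maps V g into V k. *)
Lemma covering_factor (V : dual C K -> {vspace M}) :
  covering X V -> exists W : dual C (subg_of stab) -> {vspace M}, V = W \o psi.
Proof.
move=> [_ Vact].
have leV g k : psi g = psi k -> (V g <= V k)%VS.
  move=> gk; apply/subvP => v vV.
  have [|b hb bE] := @homog_lift (k - g) 1.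
    by rewrite raddfB /= gk subrr; apply: homog1.
  by have := Vact _ _ _ _ hb vV; rewrite bE fdm_act1E subrK.
have [sec secK] := choice (@dual_res_surj _ _ _ X stab).
exists (V \o sec); apply/funext => g /=; apply/eqP.
by rewrite eqEsubv !leV ?secK.
Qed.

Lemma thin_covering_comp (W : dual C (subg_of stab) -> {vspace M}) :
  thin_covering X (W \o psi) <-> thin_covering (autgroup_res X stab) W.
Proof.
split=> -[/covering_comp cW minW]; split=> // N cN NW h.
  have [g <-] := dual_res_surj X h.
  by apply: (minW (N \o psi)) => [|k]; [apply/covering_comp | apply: NW].
have [N' NE] := covering_factor cN; move: cN; rewrite {}NE in NW * => /covering_comp cN'.
apply: (minW N') => // k; have [g <-] := dual_res_surj X k; exact: NW.
Qed.

Lemma thin_covering_bij :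
  set_bij
    [set W : dual C (subg_of stab) -> {vspace M} | thin_covering (autgroup_res X stab) W]
    [set V : dual C K -> {vspace M} | thin_covering X V]
    (fun W => W \o psi).
Proof.
split=> [W /thin_covering_comp //|W W' _ _ /= eWW'|V /= tV].
  apply/funext => h; have [g <-] := dual_res_surj X h.
  exact: (congr1 (fun V => V g) eWW').
have [W VE] := covering_factor tV.1.
by exists W => //; apply/thin_covering_comp; rewrite -VE.
Qed.

End Stabiliser.

(** * Uniqueness of graded-simple modules up to shift *)

Section GradedSimple.
Variables (C : numClosedFieldType) (A : algType C) (K : finGroupType).
Variable X : autgroup A K.
Implicit Types W : gmodule X.

Lemma grade_sum W (u : W) : exists2 c : dual C K -> W,
  forall f, c f \in grade W f & u = \sum_f c f.
Proof.
have := memvf u; rewrite -(grade_full W) => /memv_sumP[c cW ->].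
by exists c => // f; apply: cW.
Qed.

Lemma grade_independent W (c : dual C K -> W) :
  (forall f, c f \in grade W f) -> \sum_f c f = 0 -> forall f, c f = 0.
Proof.
move=> cW c0 f; have /directv_sum_independent dW := grade_direct W.
exact: (dW c (fun f _ => cW f) c0 f isT).
Qed.

Lemma act_hcomp W f g a (w : W) :
  w \in grade W g -> fdm_act W (hcomp X (f - g) a) w \in grade W f.
Proof. by move=> wg; rewrite -{2}(subrK g f); apply/grade_act/wg/hcomp_homog. Qed.

Lemma act_sum_hcomp W g a (w : W) :
  fdm_act W a w = \sum_f fdm_act W (hcomp X (f - g) a) w.
Proof.
rewrite -{1}(sum_hcomp X a) fdm_act_suml (reindex_inj (addIr (- g))).
by [].
Qed.

Lemma act0_hcomp W g a (w : W) : w \in grade W g -> fdm_act W a w = 0 ->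
  forall f, fdm_act W (hcomp X f a) w = 0.
Proof.
move=> wg; rewrite (act_sum_hcomp g) => aw0 f.
rewrite -(addrK g f).
pose c h := fdm_act W (hcomp X (h - g) a) w.
by apply: (grade_independent (c := c)) => // h; apply: act_hcomp.
Qed.

(** If a w is homogeneous, only one component of a contributes to it. *)
Lemma act_grade_homog W f g a (w : W) : w \in grade W g ->
  fdm_act W a w \in grade W f -> fdm_act W a w = fdm_act W (hcomp X (f - g) a) w.
Proof.
move=> wg awf; apply/eqP; rewrite -subr_eq0; apply/eqP.
pose c h := (if h == f then fdm_act W a w else 0) - fdm_act W (hcomp X (h - g) a) w.
have -> : fdm_act W a w - fdm_act W (hcomp X (f - g) a) w = c f by rewrite /c eqxx.
apply: grade_independent => [h|].
  by rewrite rpredB ?act_hcomp //; case: eqP => [->//|_]; apply: mem0v.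
by rewrite sumrB -act_sum_hcomp -big_mkcond big_pred1_eq subrr.
Qed.

(** The submodule A w is graded because w is homogeneous: the components of a w
are obtained by letting the components of a act on w. *)
Lemma graded_simple_orbit W g (w : W) : graded_simple_module W ->
  w \in grade W g -> w <> 0 -> forall y, exists2 a, True & fdm_act W a w = y.
Proof.
move=> [_ simW] wg w0 y.
have [| |U UP] := @vspace_of_pred _ W (fun y => exists2 a, True & fdm_act W a w = y).
- by exists 0; rewrite ?linear0 ?zero_lfunE.
- move=> k _ _ [b _ <-] [c _ <-]; exists (k *: b + c) => //.
  by rewrite fdm_actDl fdm_actZl.
apply/UP; case: (simW U) => [|U0|->]; last exact: memvf.
  split.
    apply/submoduleP => b _ /UP[c _ <-]; apply/UP.
    by exists (b * c); rewrite ?fdm_actME.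
  apply/eqP; rewrite eqEsubv; apply/andP; split; last first.
    by apply/subv_sumP => f _; apply: capvSl.
  apply/subvP => _ /UP[a _ <-]; rewrite (act_sum_hcomp g).
  apply: memv_sumr => f _; rewrite memv_cap act_hcomp // andbT.
  by apply/UP; exists (hcomp X (f - g) a).
by case: w0; apply/eqP; rewrite -memv0 -U0; apply/UP; exists 1; rewrite ?fdm_act1E.
Qed.

Lemma left_idealT : left_ideal (fun _ : A => True).
Proof. by []. Qed.

(** Among the homogeneous elements with nonzero action, one of least rank plays
the part of a primitive idempotent: left multiplication by a homogeneous
element that kills a nonzero vector of its image lowers the rank, hence gives
zero. *)
Lemma minimal_rank_homog W : fullv <> 0%VS :> {vspace W} ->
  exists g d, [/\ homog X g d, fdm_act W d <> 0 &
    forall f a (u : W), homog X f a -> fdm_act W d u <> 0 ->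
      fdm_act W (a * d) u = 0 -> fdm_act W (a * d) = 0].
Proof.
move=> W0.
pose P n := `[< exists g d,
  [/\ homog X g d, fdm_act W d <> 0 & \dim (limg (fdm_act W d)) = n] >].
have exP : exists n, P n.
  exists (\dim (limg (fdm_act W 1))); apply/asboolP; exists 0, 1.
  split=> //; first exact: homog1.
  move=> e0; apply: W0; apply/eqP; rewrite -subv0; apply/subvP => v _.
  by rewrite -[v]fdm_act1E e0 zero_lfunE mem0v.
have [_ /asboolP[g [d [hd d0 <-]]] minP] := ex_minnP exP.
exists g, d; split=> // f a u ha du adu; apply: contrapT => ad0.
have := minP (\dim (limg (fdm_act W (a * d)))).
rewrite leqNgt => /(_ _)/negP; apply.
  by apply/asboolP; exists (f + g), (a * d); split=> //; apply: homogM.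
have rk (h : 'End(W)) := limg_ker_dim h fullv.
rewrite -(ltn_add2l (\dim (fullv :&: lker (fdm_act W d)))) rk -(rk (fdm_act W (a * d))).
rewrite ltn_add2r !capfv ltnNge; apply/negP => le.
have sub : (lker (fdm_act W d) <= lker (fdm_act W (a * d)))%VS.
  by apply/subvP => v; rewrite !memv_ker fdm_actME => /eqP ->; rewrite linear0.
have /eqP e : lker (fdm_act W d) == lker (fdm_act W (a * d)) by rewrite eqEdim sub.
by apply: du; apply/eqP; rewrite -memv_ker e memv_ker adu.
Qed.

Lemma act_neq0_homog W a : fdm_act W a <> 0 ->
  exists f (w : W), w \in grade W f /\ fdm_act W a w <> 0.
Proof.
move=> a0; apply: contrapT => nex; apply: a0; apply/lfunP => u; rewrite zero_lfunE.
have [c cW ->] := grade_sum u; rewrite linear_sum big1 // => f _.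
by apply: contrapT => acf; apply: nex; exists f, (c f).
Qed.

(** Both modules are generated by d v and d v', where d has least rank on W; the
isomorphism is a (d v) |-> a (d v'). Injectivity: a nonzero homogeneous vector
of the kernel would generate d v, whose image d v' is not zero. *)
Theorem graded_simple_unique W W' :
  graded_simple_module W -> graded_simple_module W' ->
  (forall f a, homog X f a -> fdm_act W a = 0 <-> fdm_act W' a = 0) ->
  gmod_isomorphic_up_to_shift W W'.
Proof.
move=> simW simW' kill.
have [g [d [hd d0 dmin]]] := minimal_rank_homog simW.1.
have d0' : fdm_act W' d <> 0 by move/(kill _ _ hd).
have [f [v [vf dv0]]] := act_neq0_homog d0.
have [f' [v' [vf' dv0']]] := act_neq0_homog d0'.
have wg := grade_act hd vf; have wg' := grade_act hd vf'.
set w := fdm_act W d v in dv0 wg; set w' := fdm_act W' d v' in dv0' wg'.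
have gen := graded_simple_orbit simW wg dv0.
have gen' := graded_simple_orbit simW' wg' dv0'.
have [|phi phiA phiw] := @cyclic_hom _ _ W W' _ w w' left_idealT gen.
  move=> a _ /(act0_hcomp wg) aw0; rewrite -(sum_hcomp X a).
  rewrite fdm_act_suml big1 // => h _.
  rewrite -fdm_actME; have hh := hcomp_homog X h a.
  have [killW _] := kill _ _ (homogM hh hd); rewrite killW ?zero_lfunE //.
  by apply: (dmin _ _ v hh dv0); rewrite fdm_actME aw0.
have phi_w : phi w = w' by have := phiw 1 I; rewrite !fdm_act1E.
pose k := f' - f.
have kE h : h - (g + f) = h + k - (g + f').
  apply: (addIr (g + f')); rewrite !subrK -addrA; congr (h + _).
  by rewrite addrC opprD addrA [_ + _ - g]addrAC subrr add0r.
have phi_grade h u : u \in grade W h -> phi u \in grade W' (h + k).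
  have [a _ <-] := gen u; move=> /(act_grade_homog wg) ->.
  by rewrite phiw // kE act_hcomp.
(* The components of a vector of the kernel have independent images. *)
have phi_inj : lker phi == 0%VS.
  rewrite -subv0; apply/subvP => u; rewrite memv_ker => /eqP phiu.
  have [c cW uE] := grade_sum u; rewrite memv0 uE big1 // => h _.
  apply: contrapT => ch0; have [b _ bE] := graded_simple_orbit simW (cW h) ch0 w.
  apply: dv0'; rewrite -phi_w -bE phiA.
  suff -> : phi (c h) = 0 by rewrite linear0.
  rewrite -[h](addrK k).
  apply: (@grade_independent W' (fun h => phi (c (h - k)))) => [j|].
    by have := phi_grade _ _ (cW (j - k)); rewrite subrK.
  rewrite (reindex_inj (addIr k)) -[RHS]phiu uE linear_sum.
  by apply: eq_bigr => j _; rewrite addrK.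
exists k; exists (phi : 'Hom(W, gshift W' k)).
  split=> //; exists (phi^-1)%VF; first exact: lker0_lfunK.
  move=> y; apply: limg_lfunVK; have [a _ <-] := gen' y.
  by rewrite -phi_w -phiA; apply/memv_img/memvf.
move=> h; apply/eqP; rewrite eqEsubv; apply/andP; split.
  by apply/subvP => _ /memv_imgP[u /phi_grade uh ->].
apply/subvP => y; have [a _ <-] := gen' y => /= /(act_grade_homog wg') ->.
by rewrite -kE -phiw //; apply/memv_img/act_hcomp.
Qed.

(** A homogeneous element acts on each summand V h of the external sum as it
does on M, and these summands span M. *)
Lemma ext_sum_act_eq0 (M : fdmodule A) (V : dual C K -> {vspace M})
    (cV : covering X V) f a : homog X f a ->
  fdm_act (ext_sum cV) a = 0 <-> fdm_act M a = 0.
Proof.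
move=> ha; split=> a0; apply/lfunP => v; rewrite zero_lfunE; last first.
  apply/val_inj/ffunP => k; rewrite [LHS]/= (ext_actE cV) (ext_act_homog _ _ ha) a0.
  by rewrite zero_lfunE ffunE.
have := memvf v; rewrite -cV.1 => /memv_sumP[c cVk ->]; rewrite linear_sum big1 // => h _.
have := congr1 (fun F : 'End(ext_mod cV) => vsval (F (ext_inj cV h (c h))) (f + h)) a0.
rewrite [X in X = _]/= (ext_actE cV) (ext_act_homog _ _ ha) zero_lfunE [X in _ = X]ffunE.
by rewrite addrAC subrr add0r ext_injE ?cVk // eqxx.
Qed.
End GradedSimple.

(** * The correspondence theorem *)

Theorem theorem3p28 (R : realType) (A : algType R[i]) (M : fdmodule A)
    (Ghat : finGroupType) (X : autgroup A Ghat) (M_simple : simple_module M) :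
  let Hhat := twist_stab_group M X in
  let XH := autgroup_res X Hhat in
  let psi := @dual_res R[i] Ghat Hhat in
  [/\ (forall g : dual R[i] Ghat,
         fdm_act M @` [set a | homog X g a] = fdm_act M @` [set a | homog XH (psi g) a]),
      set_bij
        [set V : dual R[i] (subg_of Hhat) -> {vspace M} | thin_covering XH V]
        [set V : dual R[i] Ghat -> {vspace M} | thin_covering X V]
        (fun V => V \o psi)
    & forall (V V' : dual R[i] Ghat -> {vspace M})
        (V_thin : thin_covering X V) (V'_thin : thin_covering X V'),
        gmod_isomorphic_up_to_shift (ext_sum (proj1 V_thin)) (ext_sum (proj1 V'_thin))].
Proof.
split=> [g||V V' tV tV'].
- exact: homog_image.
- exact: thin_covering_bij.
apply: graded_simple_unique; try exact: ext_sum_graded_simple.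
move=> f a ha.
exact: iff_trans (ext_sum_act_eq0 _ ha) (iff_sym (ext_sum_act_eq0 _ ha)).
Qed.
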